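(* Let $\mathcal{Q}$ be a small quantaloid. The minimal lax extensions $\overline{\mathcal{P}},\overline{\mathcal{P}^\dagger},\overline{\mathcal{P}\mathcal{P}^\dagger},\overline{\mathcal{P}^\dagger\mathcal{P}}$ of the (co)presheaf functors $\mathcal{P},\mathcal{P}^\dagger$ and the double presheaf functors $\mathcal{P}\mathcal{P}^\dagger,\mathcal{P}^\dagger\mathcal{P}$ are flat and therefore provide the unique flat lax extensions to $\mathcal{Q}\text{-}\mathbf{Dist}$ of the corresponding 2-monads $(\mathcal{P},\mathsf{s},\mathsf{y})$, $(\mathcal{P}^\dagger,\mathsf{s}^\dagger,\mathsf{y}^\dagger)$, $(\mathcal{P}\mathcal{P}^\dagger,\mathfrak{s},\mathfrak{y})$, $(\mathcal{P}^\dagger\mathcal{P},\mathfrak{s}^\dagger,\mathfrak{y}^\dagger)$ on $\mathcal{Q}\text{-}\mathbf{Cat}$.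
   Context: A quantaloid $\mathcal{Q}$ is a category whose hom-sets are complete lattices such that composition preserves arbitrary suprema in each variable; $\mathcal{Q}_0=\mathrm{ob}\,\mathcal{Q}$. For $\alpha:p\to q,\beta:q\to r,\gamma:p\to r$: $\alpha\le\beta\searrow\gamma\iff\beta\circ\alpha\le\gamma\iff\beta\le\gamma\swarrow\alpha$; the same notation is used in $\mathcal{Q}\text{-}\mathbf{Dist}$ below. A $\mathcal{Q}$-relation $r:X\nrightarrow Y$ between sets over $\mathcal{Q}_0$ (sets with a type map $|\cdot|$ to $\mathcal{Q}_0$) is a family of morphisms $r(x,y):|x|\to|y|$ in $\mathcal{Q}$; $(s\circ r)(x,z)=\bigvee_y s(y,z)\circ r(x,y)$; the identity is $1_X^\circ$ with $1_X^\circ(x,x)=1_{|x|}$ and $1_X^\circ(x,y)=\bot$ for $x\ne y$; order pointwise. A $\mathcal{Q}$-category is $(X,a)$ with $a:X\nrightarrow X$, $1_X^\circ\le a$, $a\circ a\le a$. A $\mathcal{Q}$-functor $f:(X,a)\to(Y,b)$ is a type-preserving map with $a(x,x')\le b(fx,fx')$; $f\le g$ iff $1_{|x|}\le b(fx,gx)$ for all $x$. This gives the 2-category $\mathcal{Q}\text{-}\mathbf{Cat}$; 2-functors are functors monotone on homs; a 2-monad is a monad whose endofunctor is a 2-functor. A $\mathcal{Q}$-distributor $\varphi:(X,a)\nrightarrow(Y,b)$ is a $\mathcal{Q}$-relation with $b\circ\varphi\circ a\le\varphi$; these form the quantaloid $\mathcal{Q}\text{-}\mathbf{Dist}$ with composition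 and order as for $\mathcal{Q}$-relations and identity $1^*_{(X,a)}=a$. For a $\mathcal{Q}$-functor $f:(X,a)\to(Y,b)$: $f_*(x,y)=b(fx,y)$, $f^*(y,x)=b(y,fx)$. $\{s\}$ is the one-object $\mathcal{Q}$-category of type $s$ with hom $1_s$. $\mathcal{P}X$ consists of presheaves $\sigma:X\nrightarrow\{s\}$ ($s\in\mathcal{Q}_0$), $|\sigma|=s$, with hom $1^*_{\mathcal{P}X}(\sigma,\tau)=\tau\swarrow\sigma$; $\mathcal{P}^\dagger X$ consists of copresheaves $\sigma:\{s\}\nrightarrow X$, $|\sigma|=s$, with hom $1^*_{\mathcal{P}^\dagger X}(\sigma,\tau)=\tau\searrow\sigma$. On a $\mathcal{Q}$-functor $f:X\to Y$: $\mathcal{P}f(\sigma)=\sigma\circ f^*$, $\mathcal{P}^\dagger f(\tau)=f_*\circ\tau$. Units and multiplications: $\mathsf{y}_X:X\to\mathcal{P}X$, $x\mapsto a(-,x)$, and $\mathsf{s}_X:\mathcal{P}\mathcal{P}X\to\mathcal{P}X$, $\Sigma\mapsto\Sigma\circ(\mathsf{y}_X)_*$; $\mathsf{y}^\dagger_X:X\to\mathcal{P}^\dagger X$, $x\mapsto a(x,-)$, and $\mathsf{s}^\dagger_X:\mathcal{P}^\dagger\mathcal{P}^\dagger X\to\mathcal{P}^\dagger X$, $\Theta\mapsto(\mathsf{y}^\dagger_X)^*\circ\Theta$; $\mathfrak{y}_X=\mathsf{y}_{\mathcal{P}^\dagger X}\cdot\mathsf{y}^\dagger_X$ and $\mathfrak{s}_X:\mathcal{P}\mathcal{P}^\dagger\mathcal{P}\mathcal{P}^\dagger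 X\to\mathcal{P}\mathcal{P}^\dagger X$, $\Upsilon\mapsto\Upsilon\circ(\mathsf{y}^\dagger_{\mathcal{P}\mathcal{P}^\dagger X}\cdot\mathsf{y}_{\mathcal{P}^\dagger X})_*$; $\mathfrak{y}^\dagger_X=\mathsf{y}^\dagger_{\mathcal{P}X}\cdot\mathsf{y}_X$ and $\mathfrak{s}^\dagger_X:\mathcal{P}^\dagger\mathcal{P}\mathcal{P}^\dagger\mathcal{P}X\to\mathcal{P}^\dagger\mathcal{P}X$, $\Upsilon\mapsto(\mathsf{y}_{\mathcal{P}^\dagger\mathcal{P}X}\cdot\mathsf{y}^\dagger_{\mathcal{P}X})^*\circ\Upsilon$. These four are known to be 2-monads on $\mathcal{Q}\text{-}\mathbf{Cat}$. A lax extension of a 2-functor $\mathcal{T}$ on $\mathcal{Q}\text{-}\mathbf{Cat}$ to $\mathcal{Q}\text{-}\mathbf{Dist}$ is a lax 2-functor $\hat{\mathcal{T}}$ on $\mathcal{Q}\text{-}\mathbf{Dist}$ (monotone on homs, $1^*\le\hat{\mathcal{T}}1^*$, $\hat{\mathcal{T}}\psi\circ\hat{\mathcal{T}}\varphi\le\hat{\mathcal{T}}(\psi\circ\varphi)$) agreeing with $\mathcal{T}$ on objects, with $(\mathcal{T}f)_*\le\hat{\mathcal{T}}(f_* )$ and $(\mathcal{T}f)^*\le\hat{\mathcal{T}}(f^* )$ for all $\mathcal{Q}$-functors $f$; it is flat if these inequalities are always equalities. It is a lax extension of a 2-monad $(\mathcal{T},\mathsf{m},\mathsf{e})$ if moreover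 $(\mathsf{m}_Y)_*\circ\hat{\mathcal{T}}\hat{\mathcal{T}}\varphi\le\hat{\mathcal{T}}\varphi\circ(\mathsf{m}_X)_*$ and $(\mathsf{e}_Y)_*\circ\varphi\le\hat{\mathcal{T}}\varphi\circ(\mathsf{e}_X)_*$ for all $\varphi:X\nrightarrow Y$. The minimal (least) lax extension of $\mathcal{T}$ is $\overline{\mathcal{T}}$, with $\overline{\mathcal{T}}\varphi=(\mathcal{T}\overleftarrow{\varphi})^*\circ(\mathcal{T}\mathsf{y}_X)_*$ for $\varphi:X\nrightarrow Y$, where $\overleftarrow{\varphi}:Y\to\mathcal{P}X$, $y\mapsto\varphi(-,y)$. *)

(* Defs.v *)
From Stdlib Require Import ssreflect.
From Stdlib Require Import FunctionalExtensionality ProofIrrelevance.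

Set Implicit Arguments.
Unset Strict Implicit.
Unset Printing Implicit Defensive.

(* Every hom is a complete lattice, given by its suprema of arbitrary subsets.
   Smallness is the requirement that [ob] and [hom] live in the universe of the
   carriers of Q-categories, so that [Psh X] and [Cpsh X] below are again
   Q-categories. *)
Record Quantaloid := {
  ob : Type;
  hom : ob -> ob -> Type;
  le : forall p q, hom p q -> hom p q -> Prop;
  sup : forall p q, (hom p q -> Prop) -> hom p q;
  id1 : forall p, hom p p;
  comp : forall p q r, hom q r -> hom p q -> hom p r;
  le_refl : forall p q (u : hom p q), le u u;
  le_trans : forall p q (u v w : hom p q), le u v -> le v w -> le u w;
  le_antisym : forall p q (u v : hom p q), le u v -> le v u -> u = v;
  sup_ub : forall p q (S : hom p q -> Prop) u, S u -> le u (sup S);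
  sup_lub : forall p q (S : hom p q -> Prop) v,
    (forall u, S u -> le u v) -> le (sup S) v;
  comp_assoc : forall p q r s (w : hom r s) (v : hom q r) (u : hom p q),
    comp w (comp v u) = comp (comp w v) u;
  comp_id1l : forall p q (u : hom p q), comp (id1 q) u = u;
  comp_id1r : forall p q (u : hom p q), comp u (id1 p) = u;
  comp_supl : forall p q r (S : hom q r -> Prop) (u : hom p q),
    comp (sup S) u = sup (fun w => exists v, S v /\ w = comp v u);
  comp_supr : forall p q r (v : hom q r) (S : hom p q -> Prop),
    comp v (sup S) = sup (fun w => exists u, S u /\ w = comp v u)
}.

Arguments hom {q} _ _ : rename.
Arguments id1 {q} p : rename.
Infix "\le" := le (at level 70, no associativity).
Infix "\oq" := comp (at level 40, left associativity).

Section QuantaloidTheory.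
Variable Q : Quantaloid.

Lemma comp_le p q r (v v' : hom q r) (u u' : @hom Q p q) :
  v \le v' -> u \le u' -> v \oq u \le v' \oq u'.
Proof.
move=> hv hu; apply: (@le_trans _ _ _ _ (v' \oq u)).
- have e : v' = sup (fun w => w = v \/ w = v').
    by apply: le_antisym; [apply: sup_ub; right | apply: sup_lub => w [->|->]]
      => //; apply: le_refl.
  by rewrite e comp_supl; apply: sup_ub; exists v; split; [left|].
- have e : u' = sup (fun w => w = u \/ w = u').
    by apply: le_antisym; [apply: sup_ub; right | apply: sup_lub => w [->|->]]
      => //; apply: le_refl.
  by rewrite e comp_supr; apply: sup_ub; exists u; split; [left|].
Qed.

(* A set over [ob Q] is given by the fibres of its type map: [x : X p] says
   that [x] is an element with [|x| = p].  Type-preserving maps are then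
   families of maps between the fibres. *)
Definition QSet := ob Q -> Type.

Definition QRel (X Y : QSet) := forall p q, X p -> Y q -> @hom Q p q.

Definition rle X Y (r s : QRel X Y) :=
  forall p q (x : X p) (y : Y q), r p q x y \le s p q x y.

Definition rcomp X Y Z (s : QRel Y Z) (r : QRel X Y) : QRel X Z :=
  fun p t x z =>
    sup (fun u => exists q (y : Y q), u = s q t y z \oq r p q x y).

Inductive id_entry (X : QSet) : forall p q, X p -> X q -> hom p q -> Prop :=
  IdEntry p (x : X p) : id_entry x x (id1 p).

(* The supremum is [id1] on the diagonal, and the empty supremum elsewhere. *)
Definition rid (X : QSet) : QRel X X := fun p q x y => sup (id_entry x y).

Lemma rcomp_leP X Y Z (s : QRel Y Z) (r : QRel X Y) (t : QRel X Z) :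
  rle (rcomp s r) t <->
  forall p q o (x : X p) (y : Y q) (z : Z o), s q o y z \oq r p q x y \le t p o x z.
Proof.
split=> [h p q o x y z|h p o x z].
- by apply: le_trans (h _ _ _ _); apply: sup_ub; exists q, y.
- by apply: sup_lub => u [q [y ->]]; apply: h.
Qed.

Lemma rcomp_ub X Y Z (s : QRel Y Z) (r : QRel X Y) p q o
  (x : X p) (y : Y q) (z : Z o) : s q o y z \oq r p q x y \le rcomp s r x z.
Proof. by apply: sup_ub; exists q, y. Qed.

Lemma rcomp_above X Y Z (s : QRel Y Z) (r : QRel X Y) p q o
  (x : X p) (y : Y q) (z : Z o) u :
  u \le s q o y z \oq r p q x y -> u \le rcomp s r x z.
Proof. by move=> h; apply: (le_trans h); apply: rcomp_ub. Qed.

Lemma comp_rcomp_le X Y Z (s : QRel Y Z) (r : QRel X Y) p o t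
  (x : X p) (z : Z o) (v : hom o t) w :
  (forall q (y : Y q), v \oq (s q o y z \oq r p q x y) \le w) ->
  v \oq rcomp s r x z \le w.
Proof.
move=> h; rewrite /rcomp comp_supr.
by apply: sup_lub => _ [_ [[m [y ->]] ->]]; apply: h.
Qed.

Lemma rcomp_comp_le X Y Z (s : QRel Y Z) (r : QRel X Y) p o t
  (x : X p) (z : Z o) (v : hom t p) w :
  (forall q (y : Y q), s q o y z \oq r p q x y \oq v \le w) ->
  rcomp s r x z \oq v \le w.
Proof.
move=> h; rewrite /rcomp comp_supl.
by apply: sup_lub => _ [_ [[m [y ->]] ->]]; apply: h.
Qed.

Lemma rid_leP (X : QSet) (r : QRel X X) :
  rle (@rid X) r <-> forall p (x : X p), id1 p \le r p p x x.
Proof.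
split=> [h p x|h p q x y].
- by apply: le_trans (h _ _ _ _); apply: sup_ub.
- by apply: sup_lub => u e; destruct e; apply: h.
Qed.

Lemma rle_refl X Y (r : QRel X Y) : rle r r.
Proof. by move=> *; apply: le_refl. Qed.

Lemma rle_trans X Y (r s t : QRel X Y) : rle r s -> rle s t -> rle r t.
Proof. by move=> h1 h2 p q x y; apply: (le_trans (h1 p q x y)); apply: h2. Qed.

Lemma rle_antisym X Y (r s : QRel X Y) : rle r s -> rle s r -> r = s.
Proof.
move=> h1 h2; do 4 (apply: functional_extensionality_dep => ?).
by apply: le_antisym; [apply: h1|apply: h2].
Qed.

Lemma rcomp_le X Y Z (s s' : QRel Y Z) (r r' : QRel X Y) :
  rle s s' -> rle r r' -> rle (rcomp s r) (rcomp s' r').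
Proof.
move=> hs hr; apply/rcomp_leP => p q o x y z.
by apply: (rcomp_above (y := _)); apply: comp_le; [apply: hs|apply: hr].
Qed.

Lemma rcomp_assoc X Y Z W (t : QRel Z W) (s : QRel Y Z) (r : QRel X Y) :
  rcomp t (rcomp s r) = rcomp (rcomp t s) r.
Proof.
apply: rle_antisym; apply/rcomp_leP => p q o x y z.
- apply: comp_rcomp_le => m y'.
  rewrite comp_assoc; apply: (rcomp_above (y := y')).
  by apply: comp_le; [apply: rcomp_ub|apply: le_refl].
- apply: rcomp_comp_le => m y'.
  rewrite -comp_assoc; apply: (rcomp_above (y := y')).
  by apply: comp_le; [apply: le_refl|apply: rcomp_ub].
Qed.

Lemma rcomp_ridl X Y (r : QRel X Y) : rcomp (@rid Y) r = r.
Proof.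
apply: rle_antisym.
- apply/rcomp_leP => p q o x y z; rewrite /rid comp_supl.
  apply: sup_lub => _ [v [h ->]]; destruct h.
  by rewrite comp_id1l; apply: le_refl.
- move=> p q x y; apply: (rcomp_above (y := y)).
  rewrite -{1}[r p q x y]comp_id1l; apply: comp_le (le_refl _).
  by apply: sup_ub.
Qed.

Lemma rcomp_ridr X Y (r : QRel X Y) : rcomp r (@rid X) = r.
Proof.
apply: rle_antisym.
- apply/rcomp_leP => p q o x y z; rewrite /rid comp_supr.
  apply: sup_lub => _ [v [h ->]]; destruct h.
  by rewrite comp_id1r; apply: le_refl.
- move=> p q x y; apply: (rcomp_above (y := x)).
  rewrite -{1}[r p q x y]comp_id1r; apply: comp_le; first exact: le_refl.
  by apply: sup_ub.
Qed.

Lemma rid_l X Y (r : QRel X Y) p q o (x : X p) (y : Y q) (y' : Y o) :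
  rid y y' \oq r p q x y \le r p o x y'.
Proof.
by move: p q o x y y'; apply/rcomp_leP; rewrite rcomp_ridl; apply: rle_refl.
Qed.

Lemma rid_r X Y (r : QRel X Y) p q o (x' : X o) (x : X p) (y : Y q) :
  r p q x y \oq rid x' x \le r o q x' y.
Proof.
have /rcomp_leP h : rle (rcomp r (@rid X)) r.
  by rewrite rcomp_ridr; apply: rle_refl.
exact: h.
Qed.

End QuantaloidTheory.

Record QCat (Q : Quantaloid) := {
  carrier :> ob Q -> Type;
  qhom : QRel carrier carrier;
  qhom_refl : rle (@rid Q carrier) qhom;
  qhom_trans : rle (rcomp qhom qhom) qhom
}.
Arguments qhom {Q} X {p q} : rename.

Record QFun (Q : Quantaloid) (X Y : QCat Q) := {
  fmap :> forall p, X p -> Y p;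
  fmap_le : forall p q (x : X p) (x' : X q),
    qhom X x x' \le qhom Y (fmap x) (fmap x')
}.
Arguments fmap {Q X Y} f {p} x : rename.

Record Dist (Q : Quantaloid) (X Y : QCat Q) := {
  drel :> QRel X Y;
  drel_dist : rle (rcomp (@qhom Q Y) (rcomp drel (@qhom Q X))) drel
}.
Arguments drel {Q X Y} d {p q} x y : rename.

Definition dle (Q : Quantaloid) (X Y : QCat Q) (phi psi : Dist X Y) : Prop :=
  rle phi psi.
Infix "\led" := dle (at level 70, no associativity).

Section Basics.
Variable Q : Quantaloid.
Implicit Types X Y Z W : QCat Q.

Lemma qhom_id X p (x : X p) : id1 p \le qhom X x x.
Proof. exact: (proj1 (rid_leP _) (@qhom_refl Q X)). Qed.

Lemma qhom_comp X p q r (x : X p) (y : X q) (z : X r) :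
  qhom X y z \oq qhom X x y \le qhom X x z.
Proof. exact: (proj1 (rcomp_leP _ _ _) (@qhom_trans Q X)). Qed.

Lemma fun_ext X Y (f g : QFun X Y) :
  (forall p (x : X p), fmap f x = fmap g x) -> f = g.
Proof.
case: f g => [f hf] [g hg] /= e.
have {}e : f = g by do 2 (apply: functional_extensionality_dep => ?); apply: e.
by case: _ / e hg => hg; rewrite (proof_irrelevance _ hf hg).
Qed.

Lemma dist_ext X Y (phi psi : Dist X Y) :
  (forall p q (x : X p) (y : Y q), drel phi x y = drel psi x y) -> phi = psi.
Proof.
case: phi psi => [f hf] [g hg] /= e.
have {}e : f = g by do 4 (apply: functional_extensionality_dep => ?); apply: e.
by case: _ / e hg => hg; rewrite (proof_irrelevance _ hf hg).
Qed.

Lemma dle_refl X Y (phi : Dist X Y) : phi \led phi.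
Proof. exact: rle_refl. Qed.

Lemma dle_trans X Y (phi psi chi : Dist X Y) :
  phi \led psi -> psi \led chi -> phi \led chi.
Proof. exact: rle_trans. Qed.

Lemma dle_antisym X Y (phi psi : Dist X Y) :
  phi \led psi -> psi \led phi -> phi = psi.
Proof.
by move=> h1 h2; apply: dist_ext => p q x y; apply: le_antisym; [apply: h1|apply: h2].
Qed.

Lemma dist_r X Y (phi : Dist X Y) p q r (x : X p) (y : Y q) (y' : Y r) :
  qhom Y y y' \oq drel phi x y \le drel phi x y'.
Proof.
apply: (le_trans _ (@drel_dist _ _ _ phi _ _ x y')); apply: (rcomp_above (y := y)).
apply: comp_le (le_refl _) _; apply: (rcomp_above (y := x)).
rewrite -{1}[drel phi x y]comp_id1r.
by apply: comp_le (le_refl _) (qhom_id _).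
Qed.

Lemma dist_l X Y (phi : Dist X Y) p q r (x' : X r) (x : X p) (y : Y q) :
  drel phi x y \oq qhom X x' x \le drel phi x' y.
Proof.
apply: (le_trans _ (@drel_dist _ _ _ phi _ _ x' y)); apply: (rcomp_above (y := y)).
rewrite -{1}[_ \oq _]comp_id1l; apply: comp_le (qhom_id _) _.
exact: rcomp_ub.
Qed.

Lemma dist_intro X Y (r : QRel X Y) :
  (forall p q o (x : X p) (y : Y q) (y' : Y o), qhom Y y y' \oq r p q x y \le r p o x y') ->
  (forall p q o (x' : X o) (x : X p) (y : Y q), r p q x y \oq qhom X x' x \le r o q x' y) ->
  rle (rcomp (@qhom Q Y) (rcomp r (@qhom Q X))) r.
Proof.
move=> h1 h2; apply: (@rle_trans _ _ _ _ (rcomp (@qhom Q Y) r)).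
- by apply: rcomp_le; [apply: rle_refl|apply/rcomp_leP => *; apply: h2].
- by apply/rcomp_leP => *; apply: h1.
Qed.

Definition fid X : QFun X X.
Proof. by exists (fun _ x => x) => *; apply: le_refl. Defined.

Definition fcomp X Y Z (g : QFun Y Z) (f : QFun X Y) : QFun X Z.
Proof.
exists (fun _ x => fmap g (fmap f x)) => p q x x'.
exact: le_trans (fmap_le f x x') (fmap_le g _ _).
Defined.

Definition fle X Y (f g : QFun X Y) : Prop :=
  forall p (x : X p), id1 p \le qhom Y (fmap f x) (fmap g x).

Definition did X : Dist X X.
Proof.
by exists (@qhom Q X); apply: dist_intro => *; apply: qhom_comp.
Defined.

Definition dcomp X Y Z (psi : Dist Y Z) (phi : Dist X Y) : Dist X Z.
Proof.
exists (rcomp psi phi); apply: dist_intro => p q o.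
- move=> x y y'; apply: comp_rcomp_le => m z; rewrite comp_assoc.
  apply: (rcomp_above (y := z)); apply: comp_le (le_refl _).
  exact: dist_r.
- move=> x' x y; apply: rcomp_comp_le => m z; rewrite -comp_assoc.
  apply: (rcomp_above (y := z)); apply: comp_le (le_refl _) _.
  exact: dist_l.
Defined.

(* The residuals of Q-Dist, [gamma] "swarrow" [alpha] and [beta] "searrow"
   [gamma]; [dswarrowP] and [dsearrowP] below are their universal properties. *)
Definition dswarrow X Y Z (gamma : Dist X Z) (alpha : Dist X Y) : Dist Y Z.
Proof.
exists (fun q r y z => sup (fun v => forall p (x : X p),
  v \oq drel alpha x y \le drel gamma x z)); apply: dist_intro => p q o.
- move=> x y y'; rewrite comp_supr.
  apply: sup_lub => _ [v [h ->]]; apply: sup_ub => m z.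
  rewrite -comp_assoc; apply: le_trans (dist_r _ _ _ _).
  by apply: comp_le (le_refl _) (h _ _).
- move=> x' x y; rewrite comp_supl.
  apply: sup_lub => _ [v [h ->]]; apply: sup_ub => m z.
  rewrite -comp_assoc; apply: le_trans (h _ _).
  by apply: comp_le (le_refl _) (dist_r _ _ _ _).
Defined.

Definition dsearrow X Y Z (beta : Dist Y Z) (gamma : Dist X Z) : Dist X Y.
Proof.
exists (fun p q x y => sup (fun v => forall r (z : Z r),
  drel beta y z \oq v \le drel gamma x z)); apply: dist_intro => p q o.
- move=> x y y'; rewrite comp_supr.
  apply: sup_lub => _ [v [h ->]]; apply: sup_ub => m z.
  rewrite comp_assoc; apply: le_trans (h _ _).
  by apply: comp_le (le_refl _); apply: dist_l.
- move=> x' x y; rewrite comp_supl.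
  apply: sup_lub => _ [v [h ->]]; apply: sup_ub => m z.
  rewrite comp_assoc; apply: le_trans (dist_l _ _ _ _).
  by apply: comp_le (h _ _) (le_refl _).
Defined.

Lemma swarrow_leP X Y Z (gamma : Dist X Z) (alpha : Dist X Y) q r
  (y : Y q) (z : Z r) v :
  v \le drel (dswarrow gamma alpha) y z <->
  forall p (x : X p), v \oq drel alpha x y \le drel gamma x z.
Proof.
split=> [h p x|h]; last exact: sup_ub.
apply: le_trans (comp_le h (le_refl _)) _; rewrite /= comp_supl.
by apply: sup_lub => _ [w [hw ->]].
Qed.

Lemma searrow_leP X Y Z (beta : Dist Y Z) (gamma : Dist X Z) p q
  (x : X p) (y : Y q) v :
  v \le drel (dsearrow beta gamma) x y <->
  forall r (z : Z r), drel beta y z \oq v \le drel gamma x z.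
Proof.
split=> [h r z|h]; last exact: sup_ub.
apply: le_trans (comp_le (le_refl _) h) _; rewrite /= comp_supr.
by apply: sup_lub => _ [w [hw ->]].
Qed.

Lemma dswarrowP X Y Z (beta : Dist Y Z) (alpha : Dist X Y) (gamma : Dist X Z) :
  dcomp beta alpha \led gamma <-> beta \led dswarrow gamma alpha.
Proof.
split=> [/rcomp_leP h q r y z|h].
- by apply/swarrow_leP => p x; apply: h.
- by apply/rcomp_leP => p q o x y z; apply: (proj1 (swarrow_leP _ _ _ _ _)).
Qed.

Lemma dsearrowP X Y Z (beta : Dist Y Z) (alpha : Dist X Y) (gamma : Dist X Z) :
  dcomp beta alpha \led gamma <-> alpha \led dsearrow beta gamma.
Proof.
split=> [/rcomp_leP h p q x y|h].
- by apply/searrow_leP => r z; apply: h.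
- by apply/rcomp_leP => p q o x y z; apply: (proj1 (searrow_leP _ _ _ _ _)).
Qed.

Lemma drel_inj X Y (phi psi : Dist X Y) : @drel Q X Y phi = @drel Q X Y psi -> phi = psi.
Proof. by move=> e; apply: dist_ext => p q x y; rewrite e. Qed.

Lemma dcompA X Y Z W (chi : Dist Z W) (psi : Dist Y Z) (phi : Dist X Y) :
  dcomp chi (dcomp psi phi) = dcomp (dcomp chi psi) phi.
Proof. by apply: drel_inj; apply: rcomp_assoc. Qed.

Lemma dcomp_le X Y Z (psi psi' : Dist Y Z) (phi phi' : Dist X Y) :
  psi \led psi' -> phi \led phi' -> dcomp psi phi \led dcomp psi' phi'.
Proof. exact: rcomp_le. Qed.

Lemma dcomp_idl X Y (phi : Dist X Y) : dcomp (did Y) phi = phi.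
Proof.
apply: dle_antisym; first by apply/rcomp_leP => *; apply: dist_r.
apply: (@rle_trans _ _ _ _ (rcomp (@rid Q Y) phi)).
- by rewrite rcomp_ridl; apply: rle_refl.
- by apply: rcomp_le; [apply: qhom_refl|apply: rle_refl].
Qed.

Lemma dcomp_idr X Y (phi : Dist X Y) : dcomp phi (did X) = phi.
Proof.
apply: dle_antisym; first by apply/rcomp_leP => *; apply: dist_l.
apply: (@rle_trans _ _ _ _ (rcomp phi (@rid Q X))).
- by rewrite rcomp_ridr; apply: rle_refl.
- by apply: rcomp_le; [apply: rle_refl|apply: qhom_refl].
Qed.

Definition lower X Y (f : QFun X Y) : Dist X Y.
Proof.
exists (fun p q x y => qhom Y (fmap f x) y); apply: dist_intro => p q o.
- by move=> *; apply: qhom_comp.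
- move=> x' x y; apply: le_trans (qhom_comp _ _ _).
  by apply: comp_le (le_refl _) (fmap_le f _ _).
Defined.

Definition upper X Y (f : QFun X Y) : Dist Y X.
Proof.
exists (fun p q y x => qhom Y y (fmap f x)); apply: dist_intro => p q o.
- move=> x y y'; apply: le_trans (qhom_comp _ _ _).
  by apply: comp_le (fmap_le f _ _) (le_refl _).
- by move=> *; apply: qhom_comp.
Defined.

Lemma dcomp_lowerE X Y Z (phi : Dist Y Z) (f : QFun X Y) p q (x : X p) (z : Z q) :
  drel (dcomp phi (lower f)) x z = drel phi (fmap f x) z.
Proof.
apply: le_antisym.
- by apply: sup_lub => _ [m [y ->]]; apply: dist_l.
- apply: (rcomp_above (y := (fmap f x))).
  rewrite -{1}[drel phi _ _]comp_id1r.
  by apply: comp_le (le_refl _) (qhom_id _).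
Qed.

Lemma dcomp_upperE X Y Z (phi : Dist X Z) (f : QFun Y Z) p q (x : X p) (y : Y q) :
  drel (dcomp (upper f) phi) x y = drel phi x (fmap f y).
Proof.
apply: le_antisym.
- by apply: sup_lub => _ [m [z ->]]; apply: dist_r.
- apply: (rcomp_above (y := fmap f y)).
  rewrite -{1}[drel phi _ _]comp_id1l.
  by apply: comp_le (qhom_id _) (le_refl _).
Qed.

Lemma lower_comp X Y Z (g : QFun Y Z) (f : QFun X Y) :
  lower (fcomp g f) = dcomp (lower g) (lower f).
Proof. by apply: dist_ext => p q x y; rewrite dcomp_lowerE. Qed.

Lemma upper_comp X Y Z (g : QFun Y Z) (f : QFun X Y) :
  upper (fcomp g f) = dcomp (upper f) (upper g).
Proof. by apply: dist_ext => p q x y; rewrite dcomp_upperE. Qed.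

Lemma lower_id X : lower (fid X) = did X.
Proof. exact: dist_ext. Qed.

Lemma upper_id X : upper (fid X) = did X.
Proof. exact: dist_ext. Qed.

Lemma fle_upper X Y (f g : QFun X Y) : fle f g -> upper f \led upper g.
Proof.
move=> h p q y x /=; apply: le_trans (qhom_comp _ (fmap f x) _).
rewrite -{1}[qhom _ _ _]comp_id1l.
by apply: comp_le (h _ _) (le_refl _).
Qed.

Lemma fle_lower X Y (f g : QFun X Y) : fle f g -> lower g \led lower f.
Proof.
move=> h p q x y /=; apply: le_trans (qhom_comp _ (fmap g x) _).
rewrite -{1}[qhom _ _ _]comp_id1r.
by apply: comp_le (le_refl _) (h _ _).
Qed.

End Basics.

Section Presheaves.
Variable Q : Quantaloid.
Implicit Types X Y Z W : QCat Q.

Inductive point (s : ob Q) : ob Q -> Type := pt : point s s.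

(* The one-object Q-category {s}: [id1 s] is the only value of its hom [rid]. *)
Definition star (s : ob Q) : QCat Q.
Proof.
exists (point s) (@rid Q (point s)); first exact: rle_refl.
by rewrite rcomp_ridl; apply: rle_refl.
Defined.

(* [u : hom s t], regarded as a distributor between one-object Q-categories. *)
Definition scalar s t (u : hom s t) : Dist (star s) (star t).
Proof.
exists (fun p q (x : point s p) (y : point t q) =>
  match x in point _ p, y in point _ q return hom p q with pt _, pt _ => u end).
by rewrite [rcomp _ (@qhom Q (star s))]rcomp_ridr rcomp_ridl; apply: rle_refl.
Defined.

(* [phi(-,y)] and [phi(x,-)]. *)
Definition dist_at_r X Y (phi : Dist X Y) q (y : Y q) : Dist X (star q).
Proof.
exists (fun p r (x : X p) (z : point q r) =>
  match z in point _ r return hom p r with pt _ => drel phi x y end).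
apply: dist_intro; last by move=> p r o x' x []; apply: dist_l.
by move=> p r o x z z'; apply: (rid_l (fun p r (x : X p) (z : point q r) =>
  match z in point _ r return hom p r with pt _ => drel phi x y end)).
Defined.

Definition dist_at_l X Y (phi : Dist X Y) p (x : X p) : Dist (star p) Y.
Proof.
exists (fun r q (z : point p r) (y : Y q) =>
  match z in point _ r return hom r q with pt _ => drel phi x y end).
apply: dist_intro; first by move=> r q o [] y y'; apply: dist_r.
by move=> r q o z' z y; apply: (rid_r (fun r q (z : point p r) (y : Y q) =>
  match z in point _ r return hom r q with pt _ => drel phi x y end)).
Defined.

Lemma psh_ext X s (sigma tau : Dist X (star s)) :
  (forall p (x : X p), drel sigma x (pt s) = drel tau x (pt s)) -> sigma = tau.
Proof. by move=> h; apply: dist_ext => p q x []; apply: h. Qed.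

Lemma cpsh_ext X s (sigma tau : Dist (star s) X) :
  (forall p (x : X p), drel sigma (pt s) x = drel tau (pt s) x) -> sigma = tau.
Proof. by move=> h; apply: dist_ext => p q []; apply: h. Qed.

(* By the residual properties, for presheaves [psh_hom sigma tau] is
   [tau] "swarrow" [sigma], and for copresheaves [cpsh_hom sigma tau] is
   [tau] "searrow" [sigma]; hence the order of [Cpsh X] is opposite to [dle]. *)
Definition psh_hom X s t (sigma : Dist X (star s)) (tau : Dist X (star t)) :
  hom s t := drel (dswarrow tau sigma) (pt s) (pt t).

Definition cpsh_hom X s t (sigma : Dist (star s) X) (tau : Dist (star t) X) :
  hom s t := drel (dsearrow tau sigma) (pt s) (pt t).

Lemma psh_homP X s t (sigma : Dist X (star s)) (tau : Dist X (star t)) u :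
  u \le psh_hom sigma tau <-> dcomp (scalar u) sigma \led tau.
Proof.
apply: (iff_trans (swarrow_leP _ _ _ _ _)); split=> [h|/rcomp_leP h p x].
- by apply/rcomp_leP => p q o x [] []; apply: h.
- by move: (h _ _ _ x (pt s) (pt t)).
Qed.

Lemma cpsh_homP X s t (sigma : Dist (star s) X) (tau : Dist (star t) X) u :
  u \le cpsh_hom sigma tau <-> dcomp tau (scalar u) \led sigma.
Proof.
apply: (iff_trans (searrow_leP _ _ _ _ _)); split=> [h|/rcomp_leP h p x].
- by apply/rcomp_leP => p q o [] [] x; apply: h.
- by move: (h _ _ _ (pt s) (pt t) x).
Qed.

Definition Psh X : QCat Q.
Proof.
exists (fun s => Dist X (star s)) (fun s t sigma tau => psh_hom sigma tau).
- apply/rid_leP => s sigma; apply/swarrow_leP => p x.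
  by rewrite comp_id1l; apply: le_refl.
- apply/rcomp_leP => s t r sigma tau rho; apply/swarrow_leP => p x.
  rewrite -comp_assoc.
  apply: (@le_trans _ _ _ _ (psh_hom tau rho \oq drel tau x (pt t))).
  + apply: comp_le (le_refl _) _.
    exact: (proj1 (swarrow_leP _ _ _ _ _) (le_refl _)).
  + exact: (proj1 (swarrow_leP _ _ _ _ _) (le_refl _)).
Defined.

Definition Cpsh X : QCat Q.
Proof.
exists (fun s => Dist (star s) X) (fun s t sigma tau => cpsh_hom sigma tau).
- apply/rid_leP => s sigma; apply/searrow_leP => p x.
  by rewrite comp_id1r; apply: le_refl.
- apply/rcomp_leP => s t r sigma tau rho; apply/searrow_leP => p x.
  rewrite comp_assoc.
  apply: (@le_trans _ _ _ _ (drel tau (pt t) x \oq cpsh_hom sigma tau)).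
  + apply: comp_le (le_refl _).
    exact: (proj1 (searrow_leP _ _ _ _ _) (le_refl _)).
  + exact: (proj1 (searrow_leP _ _ _ _ _) (le_refl _)).
Defined.

Definition precomp X Y (k : Dist X Y) : QFun (Psh Y) (Psh X).
Proof.
exists (fun s (sigma : Dist Y (star s)) => dcomp sigma k : Psh X s).
move=> s t sigma tau; apply/psh_homP; rewrite dcompA.
by apply: dcomp_le (dle_refl _); apply/psh_homP; apply: le_refl.
Defined.

Definition postcomp X Y (k : Dist X Y) : QFun (Cpsh X) (Cpsh Y).
Proof.
exists (fun s (tau : Dist (star s) X) => dcomp k tau : Cpsh Y s).
move=> s t sigma tau; apply/cpsh_homP; rewrite -dcompA.
by apply: dcomp_le (dle_refl _) _; apply/cpsh_homP; apply: le_refl.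
Defined.

(* The transposes [y |-> phi(-,y)] and [x |-> phi(x,-)] of a distributor. *)
Definition ltrans X Y (phi : Dist X Y) : QFun Y (Psh X).
Proof.
exists (fun q y => dist_at_r phi y : Psh X q).
by move=> p q y y'; apply/swarrow_leP => r x; apply: (dist_r phi).
Defined.

Definition rtrans X Y (phi : Dist X Y) : QFun X (Cpsh Y).
Proof.
exists (fun p x => dist_at_l phi x : Cpsh Y p).
by move=> p q x x'; apply/searrow_leP => r y; apply: (dist_l phi).
Defined.

Definition yo X : QFun X (Psh X) := ltrans (did X).
Definition coyo X : QFun X (Cpsh X) := rtrans (did X).

Definition psh_mult X : QFun (Psh (Psh X)) (Psh X) := precomp (lower (yo X)).
Definition cpsh_mult X : QFun (Cpsh (Cpsh X)) (Cpsh X) :=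
  postcomp (upper (coyo X)).

(* The prefix [pc_] refers to P P^dagger, and [cp_] to P^dagger P. *)
Definition pc_unit X : QFun X (Psh (Cpsh X)) := fcomp (yo (Cpsh X)) (coyo X).
Definition pc_mult X :
  QFun (Psh (Cpsh (Psh (Cpsh X)))) (Psh (Cpsh X)) :=
  precomp (lower (fcomp (coyo (Psh (Cpsh X))) (yo (Cpsh X)))).

Definition cp_unit X : QFun X (Cpsh (Psh X)) := fcomp (coyo (Psh X)) (yo X).
Definition cp_mult X :
  QFun (Cpsh (Psh (Cpsh (Psh X)))) (Cpsh (Psh X)) :=
  postcomp (upper (fcomp (yo (Cpsh (Psh X))) (coyo (Psh X)))).

Lemma precomp_id X : precomp (did X) = fid (Psh X).
Proof. by apply: fun_ext => s sigma; apply: dcomp_idr. Qed.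

Lemma postcomp_id X : postcomp (did X) = fid (Cpsh X).
Proof. by apply: fun_ext => s sigma; apply: dcomp_idl. Qed.

Lemma precomp_comp X Y Z (l : Dist Y Z) (k : Dist X Y) :
  precomp (dcomp l k) = fcomp (precomp k) (precomp l).
Proof. by apply: fun_ext => s sigma; apply: dcompA. Qed.

Lemma postcomp_comp X Y Z (l : Dist Y Z) (k : Dist X Y) :
  postcomp (dcomp l k) = fcomp (postcomp l) (postcomp k).
Proof. by apply: fun_ext => s sigma; rewrite /= dcompA. Qed.

Lemma ltrans_comp X Y Z (psi : Dist Y Z) (phi : Dist X Y) :
  ltrans (dcomp psi phi) = fcomp (precomp phi) (ltrans psi).
Proof. by apply: fun_ext => s y; apply: psh_ext. Qed.

Lemma rtrans_comp X Y Z (psi : Dist Y Z) (phi : Dist X Y) :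
  rtrans (dcomp psi phi) = fcomp (postcomp psi) (rtrans phi).
Proof. by apply: fun_ext => s y; apply: cpsh_ext. Qed.

Lemma ltrans_upper X Y Z (phi : Dist X Z) (f : QFun Y Z) :
  ltrans (dcomp (upper f) phi) = fcomp (ltrans phi) f.
Proof.
by apply: fun_ext => s y; apply: psh_ext => p x; apply: dcomp_upperE.
Qed.

Lemma rtrans_lower X Y Z (phi : Dist Y Z) (f : QFun X Y) :
  rtrans (dcomp phi (lower f)) = fcomp (rtrans phi) f.
Proof.
by apply: fun_ext => s y; apply: cpsh_ext => p x; apply: dcomp_lowerE.
Qed.

Lemma ltrans_inj X Y (phi psi : Dist X Y) : ltrans phi = ltrans psi -> phi = psi.
Proof.
move=> e; apply: dist_ext => p q x y.
have e' : fmap (ltrans phi) y = fmap (ltrans psi) y by rewrite e.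
by have := f_equal (fun sigma : Dist X (star q) => drel sigma x (pt q)) e'.
Qed.

Lemma rtrans_inj X Y (phi psi : Dist X Y) : rtrans phi = rtrans psi -> phi = psi.
Proof.
move=> e; apply: dist_ext => p q x y.
have e' : fmap (rtrans phi) x = fmap (rtrans psi) x by rewrite e.
by have := f_equal (fun sigma : Dist (star p) Y => drel sigma (pt p) y) e'.
Qed.

(* The Yoneda lemma: [(yo X)_*(-,sigma) = sigma]. *)
Lemma ltrans_yo X : ltrans (lower (yo X)) = fid (Psh X).
Proof.
apply: fun_ext => s sigma; apply: psh_ext => p x /=; apply: le_antisym.
- have /= := proj1 (swarrow_leP sigma (dist_at_r (did X) x) (pt p) (pt s) _)
    (le_refl _) p x.
  apply: le_trans; rewrite -{1}[psh_hom _ _]comp_id1r.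
  exact: comp_le (le_refl _) (qhom_id _).
- by apply/swarrow_leP => q x'; apply: dist_l.
Qed.

Lemma rtrans_coyo X : rtrans (upper (coyo X)) = fid (Cpsh X).
Proof.
apply: fun_ext => s sigma; apply: cpsh_ext => p x /=; apply: le_antisym.
- have /= := proj1 (searrow_leP (dist_at_l (did X) x) sigma (pt s) (pt p) _)
    (le_refl _) p x.
  apply: le_trans; rewrite -{1}[cpsh_hom _ _]comp_id1l.
  exact: comp_le (qhom_id _) (le_refl _).
- by apply/searrow_leP => q x'; apply: dist_r.
Qed.

Lemma ltrans_id_upper X Y (f : QFun Y X) : ltrans (upper f) = fcomp (yo X) f.
Proof. by rewrite -ltrans_upper dcomp_idr. Qed.

Lemma rtrans_id_lower X Y (f : QFun X Y) : rtrans (lower f) = fcomp (coyo Y) f.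
Proof. by rewrite -rtrans_lower dcomp_idl. Qed.

Lemma fcompA X Y Z W (h : QFun Z W) (g : QFun Y Z) (f : QFun X Y) :
  fcomp h (fcomp g f) = fcomp (fcomp h g) f.
Proof. exact: fun_ext. Qed.

Lemma fcomp_idl X Y (f : QFun X Y) : fcomp (fid Y) f = f.
Proof. exact: fun_ext. Qed.

Lemma fcomp_idr X Y (f : QFun X Y) : fcomp f (fid X) = f.
Proof. exact: fun_ext. Qed.

Lemma yo_ff X : dcomp (upper (yo X)) (lower (yo X)) = did X.
Proof.
by apply: ltrans_inj; rewrite ltrans_upper ltrans_yo fcomp_idl.
Qed.

Lemma coyo_ff X : dcomp (upper (coyo X)) (lower (coyo X)) = did X.
Proof.
by apply: rtrans_inj; rewrite rtrans_lower rtrans_coyo fcomp_idl.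
Qed.

Lemma lower_precomp X Y (f : QFun X Y) :
  lower (precomp (upper f)) = upper (precomp (lower f)).
Proof.
apply: dist_ext => s t sigma tau /=; apply: le_antisym; apply/psh_homP;
  have := proj1 (psh_homP _ _ _) (le_refl _) => /(_ _ _ _ _ _) h.
- apply: (@dle_trans _ _ _ _ (dcomp (dcomp (scalar (psh_hom (dcomp sigma (upper f)) tau))
      (dcomp sigma (upper f))) (lower f))).
  + rewrite -!dcompA; apply: dcomp_le (dle_refl _) _.
    rewrite -{1}[sigma]dcomp_idr; apply: dcomp_le (dle_refl _) _.
    by move=> p q x y; rewrite dcomp_lowerE; apply: fmap_le.
  + by apply: dcomp_le (dle_refl _); apply: h.
- apply: (@dle_trans _ _ _ _ (dcomp (dcomp tau (lower f)) (upper f))).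
  + by rewrite dcompA; apply: dcomp_le (dle_refl _); apply: h.
  + rewrite -dcompA -{2}[tau]dcomp_idr; apply: dcomp_le (dle_refl _) _.
    by apply/rcomp_leP => *; apply: qhom_comp.
Qed.

Lemma upper_postcomp X Y (f : QFun X Y) :
  upper (postcomp (lower f)) = lower (postcomp (upper f)).
Proof.
apply: dist_ext => s t sigma tau /=; apply: le_antisym; apply/cpsh_homP;
  have := proj1 (cpsh_homP _ _ _) (le_refl _) => /(_ _ _ _ _ _) h.
- apply: (@dle_trans _ _ _ _ (dcomp (upper f) (dcomp (dcomp (lower f) tau)
      (scalar (cpsh_hom sigma (dcomp (lower f) tau)))))).
  + rewrite !dcompA; apply: dcomp_le (dle_refl _).
    rewrite -{1}[tau]dcomp_idl; apply: dcomp_le (dle_refl _).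
    by move=> p q x y; rewrite dcomp_lowerE; apply: fmap_le.
  + by apply: dcomp_le (dle_refl _) _; apply: h.
- apply: (@dle_trans _ _ _ _ (dcomp (lower f) (dcomp (upper f) sigma))).
  + by rewrite -dcompA; apply: dcomp_le (dle_refl _) _; apply: h.
  + rewrite dcompA -{2}[sigma]dcomp_idl; apply: dcomp_le (dle_refl _).
    by apply/rcomp_leP => *; apply: qhom_comp.
Qed.

Lemma precomp_le X Y (k l : Dist X Y) :
  k \led l -> fle (precomp k) (precomp l).
Proof.
move=> h s sigma; apply/swarrow_leP => p x; rewrite comp_id1l.
exact: dcomp_le (dle_refl _) h _ _ _ _.
Qed.

Lemma postcomp_le X Y (k l : Dist X Y) :
  k \led l -> fle (postcomp l) (postcomp k).
Proof.
move=> h s sigma; apply/searrow_leP => p x; rewrite comp_id1r.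
exact: dcomp_le h (dle_refl _) _ _ _ _.
Qed.

End Presheaves.

Record TwoFunctor (Q : Quantaloid) := {
  tob :> QCat Q -> QCat Q;
  tmap : forall X Y, QFun X Y -> QFun (tob X) (tob Y);
  tmap_id : forall X, tmap (fid X) = fid (tob X);
  tmap_comp : forall X Y Z (g : QFun Y Z) (f : QFun X Y),
    tmap (fcomp g f) = fcomp (tmap g) (tmap f);
  tmap_le : forall X Y (f g : QFun X Y), fle f g -> fle (tmap f) (tmap g)
}.
Arguments tmap {Q} T {X Y} f : rename.

Record TwoMonad (Q : Quantaloid) := {
  mfun :> TwoFunctor Q;
  mmult : forall X, QFun (mfun (mfun X)) (mfun X);
  munit : forall X, QFun X (mfun X);
  mmult_nat : forall X Y (f : QFun X Y),
    fcomp (tmap mfun f) (mmult X) = fcomp (mmult Y) (tmap mfun (tmap mfun f));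
  munit_nat : forall X Y (f : QFun X Y),
    fcomp (tmap mfun f) (munit X) = fcomp (munit Y) f;
  mmult_unitl : forall X, fcomp (mmult X) (munit (mfun X)) = fid (mfun X);
  mmult_unitr : forall X, fcomp (mmult X) (tmap mfun (munit X)) = fid (mfun X);
  mmult_assoc : forall X,
    fcomp (mmult X) (mmult (mfun X)) = fcomp (mmult X) (tmap mfun (mmult X))
}.
Arguments mmult {Q} M X : rename.
Arguments munit {Q} M X : rename.

Section LaxExtensions.
Variable Q : Quantaloid.
Implicit Types (T : TwoFunctor Q) (M : TwoMonad Q).

(* The action on homs of a candidate lax extension; its action on objects is
   that of [T]. *)
Definition DistAction T :=
  forall X Y : QCat Q, Dist X Y -> Dist (T X) (T Y).

Record LaxExtension T (E : DistAction T) : Prop := {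
  lax_le : forall X Y (phi psi : Dist X Y), phi \led psi -> E X Y phi \led E X Y psi;
  lax_id : forall X, did (T X) \led E X X (did X);
  lax_comp : forall X Y Z (psi : Dist Y Z) (phi : Dist X Y),
    dcomp (E Y Z psi) (E X Y phi) \led E X Z (dcomp psi phi);
  lax_lower : forall X Y (f : QFun X Y), lower (tmap T f) \led E X Y (lower f);
  lax_upper : forall X Y (f : QFun X Y), upper (tmap T f) \led E Y X (upper f)
}.

Definition Flat T (E : DistAction T) : Prop :=
  forall X Y (f : QFun X Y),
    lower (tmap T f) = E X Y (lower f) /\ upper (tmap T f) = E Y X (upper f).

Record MonadLaxExtension M (E : DistAction M) : Prop := {
  mlax_fun : LaxExtension E;
  mlax_mult : forall X Y (phi : Dist X Y),
    dcomp (lower (mmult M Y)) (E _ _ (E X Y phi)) \led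
    dcomp (E X Y phi) (lower (mmult M X));
  mlax_unit : forall X Y (phi : Dist X Y),
    dcomp (lower (munit M Y)) phi \led dcomp (E X Y phi) (lower (munit M X))
}.

Definition MinimalLaxExtension T (E : DistAction T) : Prop :=
  LaxExtension E /\
  forall E' : DistAction T, LaxExtension E' ->
    forall X Y (phi : Dist X Y), E X Y phi \led E' X Y phi.

Definition UniqueFlatLaxExtension M (E : DistAction M) : Prop :=
  MonadLaxExtension E /\ Flat E /\
  forall E' : DistAction M, MonadLaxExtension E' -> Flat E' ->
    forall X Y (phi : Dist X Y), E' X Y phi = E X Y phi.

(* Here [ltrans phi] is [y |-> phi(-,y)]. *)
Definition minext T : DistAction T := fun X Y phi =>
  dcomp (upper (tmap T (ltrans phi))) (lower (tmap T (yo X))).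

End LaxExtensions.

Section Monads.
Variable Q : Quantaloid.

Definition psh_functor : TwoFunctor Q.
Proof.
exists (@Psh Q) (fun X Y f => precomp (upper f)).
- by move=> X; rewrite upper_id precomp_id.
- by move=> X Y Z g f; rewrite upper_comp precomp_comp.
- by move=> X Y f g h; apply: precomp_le; apply: fle_upper.
Defined.

Definition cpsh_functor : TwoFunctor Q.
Proof.
exists (@Cpsh Q) (fun X Y f => postcomp (lower f)).
- by move=> X; rewrite lower_id postcomp_id.
- by move=> X Y Z g f; rewrite lower_comp postcomp_comp.
- by move=> X Y f g h; apply: postcomp_le; apply: fle_lower.
Defined.

Definition two_comp (G F : TwoFunctor Q) : TwoFunctor Q.
Proof.
exists (fun X => G (F X)) (fun X Y f => tmap G (tmap F f)).
- by move=> X; rewrite !tmap_id.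
- by move=> X Y Z g f; rewrite !tmap_comp.
- by move=> X Y f g h; do 2 apply: tmap_le.
Defined.

Lemma yo_nat X Y (f : @QFun Q X Y) :
  fcomp (precomp (upper f)) (yo X) = fcomp (yo Y) f.
Proof. by rewrite -ltrans_comp dcomp_idl ltrans_id_upper. Qed.

Lemma coyo_nat X Y (f : @QFun Q X Y) :
  fcomp (postcomp (lower f)) (coyo X) = fcomp (coyo Y) f.
Proof. by rewrite -rtrans_comp dcomp_idr rtrans_id_lower. Qed.

Definition psh_monad : TwoMonad Q.
Proof.
exists psh_functor (@psh_mult Q) (@yo Q) => /=.
- move=> X Y f; rewrite /psh_mult -!precomp_comp; refine (f_equal (@precomp Q _ _) _).
  by apply: ltrans_inj; rewrite ltrans_comp ltrans_upper !ltrans_yo fcomp_idr fcomp_idl.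
- exact: yo_nat.
- by move=> X; rewrite -ltrans_comp dcomp_idl ltrans_yo.
- by move=> X; rewrite -precomp_comp yo_ff precomp_id.
- move=> X; rewrite -!precomp_comp; refine (f_equal (@precomp Q _ _) _).
  by apply: ltrans_inj; rewrite ltrans_comp ltrans_upper !ltrans_yo fcomp_idr fcomp_idl.
Defined.

Definition cpsh_monad : TwoMonad Q.
Proof.
exists cpsh_functor (@cpsh_mult Q) (@coyo Q) => /=.
- move=> X Y f; rewrite /cpsh_mult -!postcomp_comp; refine (f_equal (@postcomp Q _ _) _).
  by apply: rtrans_inj; rewrite rtrans_comp rtrans_lower !rtrans_coyo fcomp_idr fcomp_idl.
- exact: coyo_nat.
- by move=> X; rewrite -rtrans_comp dcomp_idr rtrans_coyo.
- by move=> X; rewrite -postcomp_comp coyo_ff postcomp_id.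
- move=> X; rewrite -!postcomp_comp; refine (f_equal (@postcomp Q _ _) _).
  by apply: rtrans_inj; rewrite rtrans_comp rtrans_lower !rtrans_coyo fcomp_idr fcomp_idl.
Defined.

Definition pc_monad : TwoMonad Q.
Proof.
exists (two_comp psh_functor cpsh_functor) (@pc_mult Q) (@pc_unit Q) => /=.
- move=> X Y f; rewrite /pc_mult -!precomp_comp; refine (f_equal (@precomp Q _ _) _).
  rewrite !upper_postcomp -!lower_comp; refine (f_equal (@lower Q _ _) _).
  rewrite fcompA -rtrans_comp dcomp_idr -rtrans_id_lower -!rtrans_lower.
  refine (f_equal (@rtrans Q _ _) _); apply: ltrans_inj.
  by rewrite ltrans_comp ltrans_upper !ltrans_yo fcomp_idl fcomp_idr.
- move=> X Y f.
  by rewrite /pc_unit fcompA yo_nat -!fcompA coyo_nat.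
- move=> X; rewrite /pc_mult /pc_unit fcompA -ltrans_comp dcomp_idl.
  by rewrite -ltrans_upper lower_comp dcompA coyo_ff dcomp_idl ltrans_yo.
- move=> X; rewrite /pc_mult -precomp_comp upper_postcomp -lower_comp.
  rewrite fcompA -rtrans_comp dcomp_idr /pc_unit -rtrans_lower upper_comp.
  by rewrite -dcompA yo_ff dcomp_idr rtrans_coyo lower_id precomp_id.
- move=> X; rewrite /pc_mult -[LHS]precomp_comp -[RHS]precomp_comp.
  refine (f_equal (@precomp Q _ _) _).
  rewrite upper_postcomp -[LHS]lower_comp -[RHS]lower_comp.
  refine (f_equal (@lower Q _ _) _).
  rewrite [in RHS]fcompA -rtrans_comp dcomp_idr -rtrans_lower -fcompA.
  rewrite -rtrans_id_lower; refine (f_equal (@rtrans Q _ _) _).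
  apply: ltrans_inj; rewrite ltrans_upper ltrans_yo fcomp_idl.
  by rewrite lower_comp ltrans_comp ltrans_yo fcomp_idr.
Defined.

Definition cp_monad : TwoMonad Q.
Proof.
exists (two_comp cpsh_functor psh_functor) (@cp_mult Q) (@cp_unit Q) => /=.
- move=> X Y f; rewrite /cp_mult -!postcomp_comp; refine (f_equal (@postcomp Q _ _) _).
  rewrite !lower_precomp -!upper_comp; refine (f_equal (@upper Q _ _) _).
  rewrite fcompA -ltrans_comp dcomp_idl -ltrans_id_upper -!ltrans_upper.
  refine (f_equal (@ltrans Q _ _) _); apply: rtrans_inj.
  by rewrite rtrans_comp rtrans_lower !rtrans_coyo fcomp_idl fcomp_idr.
- move=> X Y f.
  by rewrite /cp_unit fcompA coyo_nat -!fcompA yo_nat.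
- move=> X; rewrite /cp_mult /cp_unit fcompA -rtrans_comp dcomp_idr.
  by rewrite -rtrans_lower upper_comp -dcompA yo_ff dcomp_idr rtrans_coyo.
- move=> X; rewrite /cp_mult -postcomp_comp lower_precomp -upper_comp.
  rewrite fcompA -ltrans_comp dcomp_idl /cp_unit -ltrans_upper lower_comp.
  by rewrite dcompA coyo_ff dcomp_idl ltrans_yo upper_id postcomp_id.
- move=> X; rewrite /cp_mult -[LHS]postcomp_comp -[RHS]postcomp_comp.
  refine (f_equal (@postcomp Q _ _) _).
  rewrite lower_precomp -[LHS]upper_comp -[RHS]upper_comp.
  refine (f_equal (@upper Q _ _) _).
  rewrite [in RHS]fcompA -ltrans_comp dcomp_idl -ltrans_upper -fcompA.
  rewrite -ltrans_id_upper; refine (f_equal (@ltrans Q _ _) _).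
  apply: rtrans_inj; rewrite rtrans_lower rtrans_coyo fcomp_idl.
  by rewrite upper_comp rtrans_comp rtrans_coyo fcomp_idr.
Defined.

End Monads.

(* Main.v *)
From Stdlib Require Import ssreflect.
Require Import Defs.

(** The calculations use the adjunctions [lower f -| upper f] in Q-Dist.  For
    every 2-functor [T], [minext T] is the least lax extension, because
    [phi = upper (ltrans phi) o lower (yo X)] and
    [ltrans (psi o phi) = precomp phi o ltrans psi].  If [T] preserves full
    faithfulness ([upper f o lower f = 1]), then [minext T] is flat: on [upper f]
    because [ltrans (upper f) = yo o f], and on [lower f] because [T] preserves
    the adjunction [precomp (upper f) -| precomp (lower f)].  A flat lax extension
    [E] satisfies [E (upper f o phi) = upper (T f) o E phi]; hence it is unique,
    and the monad inequalities reduce to the naturality of the multiplication and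
    the unit.  Finally, presheaf functors preserve full faithfulness because
    [precomp (upper f)] has the adjoint [precomp (lower f)], and dually. *)

Set Implicit Arguments.
Unset Strict Implicit.
Unset Printing Implicit Defensive.

Section Adjunctions.
Variable Q : Quantaloid.
Implicit Types X Y Z W : QCat Q.

Lemma lower_unit X Y (f : QFun X Y) : did X \led dcomp (upper f) (lower f).
Proof. by move=> p q x y; rewrite dcomp_lowerE; apply: fmap_le. Qed.

Lemma lower_counit X Y (f : QFun X Y) : dcomp (lower f) (upper f) \led did Y.
Proof. by apply/rcomp_leP => *; apply: qhom_comp. Qed.

Lemma lower_shift X Y Z (f : QFun Y Z) (phi : Dist X Y) (psi : Dist X Z) :
  dcomp (lower f) phi \led psi -> phi \led dcomp (upper f) psi.
Proof.
move=> h; apply: (@dle_trans _ _ _ _ (dcomp (upper f) (dcomp (lower f) phi))).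
- rewrite dcompA -{1}[phi]dcomp_idl.
  exact: dcomp_le (lower_unit f) (dle_refl _).
- exact: dcomp_le (dle_refl _) h.
Qed.

Lemma upper_cancel X Y Z (f : QFun X Y) (phi : Dist Z Y) :
  dcomp (lower f) (dcomp (upper f) phi) \led phi.
Proof.
rewrite dcompA -{2}[phi]dcomp_idl.
exact: dcomp_le (lower_counit f) (dle_refl _).
Qed.

Lemma lower_cancel X Y Z (f : QFun X Y) (phi : Dist Y Z) :
  dcomp (dcomp phi (lower f)) (upper f) \led phi.
Proof.
rewrite -dcompA -{2}[phi]dcomp_idr.
exact: dcomp_le (dle_refl _) (lower_counit f).
Qed.

(** The Beck-Chevalley inequality: the mate of the square under the adjunctions [lower h -| upper h]
    and [lower g -| upper g]. *)
Lemma lower_upper_square X Y Z W (f : QFun X Y) (g : QFun X Z)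
    (h : QFun Y W) (k : QFun Z W) :
  fcomp h f = fcomp k g ->
  dcomp (lower f) (upper g) \led dcomp (upper h) (lower k).
Proof.
move=> e; apply: lower_shift.
by rewrite dcompA -lower_comp e lower_comp; apply: lower_cancel.
Qed.

Lemma upper_le_fle X Y (f g : QFun X Y) : upper f \led upper g -> fle f g.
Proof. by move=> h p x; apply: le_trans (qhom_id _) (h _ _ _ _). Qed.

(** Trades the form of an adjunction used for calculating in Q-Dist for its unit and counit in
    Q-Cat, which any 2-functor preserves. *)
Lemma adjoint_fleP X Y (f : QFun X Y) (g : QFun Y X) :
  lower f = upper g <-> fle (fid X) (fcomp g f) /\ fle (fcomp f g) (fid Y).
Proof.
split=> [e|[h1 h2]].
- split; apply: upper_le_fle; rewrite upper_comp upper_id -e.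
  + exact: lower_unit.
  + by rewrite e -[upper g]e; apply: lower_counit.
- apply: dle_antisym.
  + rewrite -[upper g]dcomp_idr; apply: lower_shift.
    by rewrite -lower_comp -lower_id; apply: fle_lower.
  + apply: (@dle_trans _ _ _ _ (dcomp (dcomp (lower f) (lower g)) (upper g)));
      last exact: lower_cancel.
    rewrite -{1}[upper g]dcomp_idl; apply: dcomp_le (dle_refl _).
    by rewrite -lower_comp -lower_id; apply: fle_lower.
Qed.

Lemma tmap_adjoint (T : TwoFunctor Q) X Y (f : QFun X Y) (g : QFun Y X) :
  lower f = upper g -> lower (tmap T f) = upper (tmap T g).
Proof.
move=> /adjoint_fleP [h1 h2]; apply/adjoint_fleP.
by split; rewrite -tmap_comp -tmap_id; apply: tmap_le.
Qed.

Lemma fcomp_precomp_yo X Y (phi : Dist X Y) :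
  fcomp (precomp phi) (yo Y) = ltrans phi.
Proof. by rewrite -ltrans_comp dcomp_idl. Qed.

Lemma ltrans_le X Y (phi psi : Dist X Y) :
  phi \led psi -> fle (ltrans phi) (ltrans psi).
Proof.
move=> h; rewrite -!fcomp_precomp_yo => p y.
exact: (precomp_le h).
Qed.

Lemma ltrans_factor X Y (phi : Dist X Y) :
  dcomp (upper (ltrans phi)) (lower (yo X)) = phi.
Proof. by apply: ltrans_inj; rewrite ltrans_upper ltrans_yo fcomp_idl. Qed.

Definition fully_faithful X Y (f : QFun X Y) : Prop :=
  dcomp (upper f) (lower f) = did X.

Definition preserves_ff (T : TwoFunctor Q) : Prop :=
  forall X Y (f : QFun X Y), fully_faithful f -> fully_faithful (tmap T f).

(** Once [lower] becomes an [upper], the composite is [upper (precomp (dcomp (upper f) (lower f)))],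
    where the hypothesis applies. *)
Lemma psh_preserves_ff : preserves_ff (psh_functor Q).
Proof.
move=> X Y f ff; rewrite /fully_faithful /= lower_precomp -upper_comp.
by rewrite -precomp_comp ff precomp_id upper_id.
Qed.

Lemma cpsh_preserves_ff : preserves_ff (cpsh_functor Q).
Proof.
move=> X Y f ff; rewrite /fully_faithful /= upper_postcomp -lower_comp.
by rewrite -postcomp_comp ff postcomp_id lower_id.
Qed.

Lemma two_comp_preserves_ff (G F : TwoFunctor Q) :
  preserves_ff G -> preserves_ff F -> preserves_ff (two_comp G F).
Proof. by move=> hG hF X Y f ff; apply/hG/hF. Qed.

End Adjunctions.

Section MinimalExtension.
Variable Q : Quantaloid.
Implicit Types X Y Z : QCat Q.
Implicit Types (T : TwoFunctor Q) (M : TwoMonad Q).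

Lemma minext_lax T : LaxExtension (minext T).
Proof.
split.
- move=> X Y phi psi h; apply: dcomp_le (dle_refl _).
  by apply/fle_upper/tmap_le/ltrans_le.
- by move=> X; apply: lower_unit.
- move=> X Y Z psi phi; rewrite /minext ltrans_comp tmap_comp upper_comp.
  rewrite dcompA; apply: dcomp_le (dle_refl _).
  rewrite -dcompA; apply: dcomp_le (dle_refl _) _.
  (* Factoring [ltrans phi] through [yo Y] puts [upper (tmap T (yo Y))] next to its [lower], and the
     counit cancels the pair. *)
  rewrite -fcomp_precomp_yo tmap_comp upper_comp.
  exact: upper_cancel.
- move=> X Y f; apply: lower_shift.
  rewrite -lower_comp -tmap_comp; apply/fle_lower/tmap_le.
  (* [fcomp (ltrans (lower f)) f] transposes [dcomp (upper f) (lower f)], which lies above [did X];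
     [lower] has reversed the order. *)
  rewrite -ltrans_upper -[yo X]/(ltrans (did X)).
  exact/ltrans_le/lower_unit.
- move=> Y X f; rewrite /minext ltrans_id_upper tmap_comp upper_comp -dcompA.
  rewrite -{1}[upper _]dcomp_idr.
  exact: dcomp_le (dle_refl _) (lower_unit _).
Qed.

Lemma minext_least T (E : DistAction T) X Y (phi : Dist X Y) :
  LaxExtension E -> minext T phi \led E X Y phi.
Proof.
move=> hE; rewrite -{2}[phi]ltrans_factor.
apply: dle_trans (lax_comp hE _ _).
exact: dcomp_le (lax_upper hE _) (lax_lower hE _).
Qed.

Lemma minext_minimal T : MinimalLaxExtension (minext T).
Proof.
by split=> [|E hE X Y phi]; [apply: minext_lax|apply: minext_least].
Qed.

Lemma minext_flat T : preserves_ff T -> Flat (minext T).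
Proof.
move=> hT.
have Tyo X : dcomp (upper (tmap T (yo X))) (lower (tmap T (yo X))) = did (T X).
  exact/hT/yo_ff.
move=> X Y f; split.
- rewrite /minext -fcomp_precomp_yo tmap_comp upper_comp.
  (* With [lower] on the right factors, naturality of [yo] moves [f] to the right of [yo Y], so that
     [Tyo] applies. *)
  rewrite -(tmap_adjoint T (lower_precomp f)) -dcompA -lower_comp -tmap_comp.
  by rewrite yo_nat tmap_comp lower_comp dcompA Tyo dcomp_idl.
- by rewrite /minext ltrans_id_upper tmap_comp upper_comp -dcompA Tyo dcomp_idr.
Qed.

(** One half is laxity. The other transposes along [tmap T f], where flatness turns
    [lower (tmap T f)] into [E (lower f)], so that laxity and the counit apply. *)
Lemma flat_upper T (E : DistAction T) X Y Z (f : QFun Z Y) (phi : Dist X Y) :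
  LaxExtension E -> Flat E ->
  E X Z (dcomp (upper f) phi) = dcomp (upper (tmap T f)) (E X Y phi).
Proof.
move=> hE hF; have [hl hu] := hF _ _ f; apply: dle_antisym.
- apply: lower_shift; rewrite hl.
  apply: dle_trans (lax_comp hE _ _) _.
  exact/(lax_le hE)/upper_cancel.
- by rewrite hu; apply: lax_comp.
Qed.

Lemma flat_eq_minext T (E : DistAction T) X Y (phi : Dist X Y) :
  LaxExtension E -> Flat E -> E X Y phi = minext T phi.
Proof.
move=> hE hF; rewrite -{1}[phi]ltrans_factor flat_upper //.
by rewrite -(proj1 (hF _ _ _)).
Qed.

Lemma minext_unique_flat M :
  preserves_ff M -> UniqueFlatLaxExtension (M := M) (minext M).
Proof.
move=> hM; have hE := minext_lax M; have hF := minext_flat hM.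
split; last by split=> // E [hE' _ _] hF' X Y phi; apply: flat_eq_minext.
split=> // X Y phi.
(* Flatness rewrites the double extension as [lower] of [TT (yo X)] followed by [upper] of
   [TT g]. *)
- set g := ltrans phi; rewrite {2}/minext flat_upper // -(proj1 (hF _ _ _)) -/g.
  rewrite dcompA /minext -/g -[X in _ \led X]dcompA.
  (* Naturality at [yo X] gives both sides the same first factor; the rest is the mate of naturality
     at [g]. *)
  rewrite -[X in _ \led dcomp _ X]lower_comp mmult_nat lower_comp dcompA.
  by apply: dcomp_le (dle_refl _); apply/lower_upper_square/mmult_nat.
- rewrite -{1}[phi]ltrans_factor /minext -dcompA -lower_comp munit_nat.
  rewrite lower_comp !dcompA; apply: dcomp_le (dle_refl _).
  by apply: lower_upper_square; apply: munit_nat.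
Qed.

Lemma minext_minimal_flat_unique M : preserves_ff M ->
  MinimalLaxExtension (minext M) /\ Flat (minext M) /\
  UniqueFlatLaxExtension (M := M) (minext M).
Proof.
move=> hM; split; first exact: minext_minimal.
by split; [apply: minext_flat|apply: minext_unique_flat].
Qed.

End MinimalExtension.

Theorem proposition5p1 (Q : Quantaloid) :
  (MinimalLaxExtension (minext (psh_functor Q)) /\
   Flat (minext (psh_functor Q)) /\
   UniqueFlatLaxExtension (M := psh_monad Q) (minext (psh_functor Q))) /\
  (MinimalLaxExtension (minext (cpsh_functor Q)) /\
   Flat (minext (cpsh_functor Q)) /\
   UniqueFlatLaxExtension (M := cpsh_monad Q) (minext (cpsh_functor Q))) /\
  (MinimalLaxExtension (minext (two_comp (psh_functor Q) (cpsh_functor Q))) /\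
   Flat (minext (two_comp (psh_functor Q) (cpsh_functor Q))) /\
   UniqueFlatLaxExtension (M := pc_monad Q)
     (minext (two_comp (psh_functor Q) (cpsh_functor Q)))) /\
  (MinimalLaxExtension (minext (two_comp (cpsh_functor Q) (psh_functor Q))) /\
   Flat (minext (two_comp (cpsh_functor Q) (psh_functor Q))) /\
   UniqueFlatLaxExtension (M := cp_monad Q)
     (minext (two_comp (cpsh_functor Q) (psh_functor Q)))).
Proof.
have hP := @psh_preserves_ff Q; have hC := @cpsh_preserves_ff Q.
split; first exact: (minext_minimal_flat_unique (M := psh_monad Q)).
split; first exact: (minext_minimal_flat_unique (M := cpsh_monad Q)).
split.
- by apply: (minext_minimal_flat_unique (M := pc_monad Q));
    apply: two_comp_preserves_ff.
- by apply: (minext_minimal_flat_unique (M := cp_monad Q));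
    apply: two_comp_preserves_ff.
Qed.
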